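(* Let $K$ be an oriented, non-split alternating link in $S^3$, and let $P_K(x,y,z,w)\in\mathbb{Z}[x^{-1},y^{-1},z,w]$ be the spanning-tree polynomial defined in the context. Then $$P_K(x,y,1,1)=P_K(y,x,1,1)\qquad\text{and}\qquad P_K(1,1,z,w)=P_K(1,1,w,z).$$
   Context: All links are oriented and non-split. A link is alternating if it has a diagram in which each component alternates between over- and undercrossings (an alternating diagram). Crossing signs: rotate the picture so both strands point upward; the crossing is positive if the overstrand runs from lower left to upper right, negative if it runs from lower right to upper left. Tait digraph. Let $D\subset\mathbb{R}^2$ be an alternating diagram of a non-split link. Regions of $D$ are the components of the complement of the underlying 4-valent plane graph. Choose the checkerboard shading of the regions such that at every crossing, when the picture is rotated so that the overstrand runs from lower left to upper right, the top and bottom regions are the shaded ones. The Tait digraph $G=(V,E)$ is the plane digraph with one vertex in each shaded region and one edge through each crossing, joining the vertices of the two shaded regions at that crossing (loops and multiple edges allowed), directed to match the overcrossing: rotating so that the overstrand is directed from lower left to upper right, the edge points from the bottom region to the top region. An edge is positive or negative according to the sign of its crossing; $E=E_+\sqcup E_-$. Activities. Fix a root vertex $r\in V$ and a basepoint $q\in\mathbb{R}^2\setminus G$. Let $T$ be a spanning tree of $G$ (viewed as a set of edges). An edge $e\in T$ is internally semi-active if it points away from the component of $T\setminus\{e\}$ containing $r$, and internally semi-passive otherwise. For $e\in E\setminus T$, let $\mathrm{Cyc}_T(e)$ be the unique cycle in $T\cup\{e\}$, oriented counter-clockwise around $q$ in $\mathbb{R}^2\cup\{\infty\}$ (so that the side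 containing $q$ lies on its left); $e$ is externally semi-active if its direction agrees with this orientation, and externally semi-passive otherwise. Let $\iota_+(T)$, $\overline{\iota}_+(T)$ be the numbers of internally semi-active, respectively semi-passive, edges in $T\cap E_+$, and $\varepsilon_-(T)$, $\overline{\varepsilon}_-(T)$ the numbers of externally semi-active, respectively semi-passive, edges in $E_-\setminus T$. The polynomial. For an alternating diagram $D$ of $K$ with Tait digraph $G$, a root $r$, and a basepoint $q$ in a face of $G$ adjacent to $r$ (its boundary contains $r$), $$P_K(x,y,z,w)=\sum_{T}x^{-\iota_+(T)}y^{-\overline{\iota}_+(T)}z^{\varepsilon_-(T)}w^{\overline{\varepsilon}_-(T)},$$ summed over all spanning trees $T$ of $G$. It does not depend on the choice of alternating diagram or of adjacent pair $(r,q)$. *)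

(* Defs.v *)
From HB Require Import structures.
From mathcomp Require Import all_boot all_order all_algebra.
From mathcomp Require Export mpoly.

Set Implicit Arguments.
Unset Strict Implicit.
Unset Printing Implicit Defensive.

Import GRing.Theory.
Local Open Scope ring_scope.

(** * Oriented link diagrams

  The half-edges at a crossing [c] are [(c, 0), (c, 1), (c, 2), (c, 3)] in
  counter-clockwise order; the understrand joins the even ones and the
  overstrand the odd ones.  [mate] says which half-edges are joined by an edge
  of the underlying 4-valent graph.  Components of the link without crossings
  are listed separately in [circle], so that the crossingless diagram of the
  unknot is covered. *)

Record diagram_code := DiagramCode {
  crossing : finType;
  circle : finType;
  mate : crossing * 'I_4 -> crossing * 'I_4;
  outgoing : crossing * 'I_4 -> bool; (* the orientation leaves the crossing *)
  mateK : involutive mate;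
  outgoing_mate : forall h, outgoing (mate h) = ~~ outgoing h;
  outgoing_opposite : forall c i,
    outgoing (c, ordS (ordS i)) = ~~ outgoing (c, i) }.

Definition over_half (D : diagram_code) (h : crossing D * 'I_4) : bool :=
  odd h.2.

(* A dart is an edge of the diagram with a direction of travel: [inl h] leaves
   the crossing of [h] along [h]; [inr (o, b)] runs around the circle [o], along
   its orientation if [b] and against it otherwise. *)
Definition dart (D : diagram_code) : finType :=
  (crossing D * 'I_4 + circle D * bool)%type.

Definition flip (D : diagram_code) (d : dart D) : dart D :=
  match d with
  | inl h => inl (mate h)
  | inr (o, b) => inr (o, ~~ b)
  end.

(* Keeping the region on the left of a dart [inl h] always on the left, at the
   next crossing one continues along the clockwise neighbour of [mate h]. *)
Definition next_side (D : diagram_code) (d : dart D) : dart D :=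
  match d with
  | inl h => inl ((mate h).1, ord_pred (mate h).2)
  | inr _ => d
  end.

Definition side_orbit (D : diagram_code) (d : dart D) : {set dart D} :=
  [set d' | fconnect (@next_side D) d d'].

(* For a connected diagram on the sphere every region is a disc, hence is
   determined by the set of darts that have it on their left. *)
Definition region (D : diagram_code) : finType :=
  {A : {set dart D} | A \in codom (@side_orbit D)}.

(* The region on the left of [d]; that of [inl (c, i)] occupies the corner at
   [c] between [(c, i)] and [(c, i + 1)]. *)
Definition left_region (D : diagram_code) (d : dart D) : region D :=
  exist _ (side_orbit d) (codom_f (@side_orbit D) d).

Definition dart_adjacent (D : diagram_code) : rel (dart D) :=
  fun d d' => (d' == flip d) ||
    match d, d' with
    | inl h, inl h' => h.1 == h'.1
    | _, _ => false
    end.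

(* Euler's formula: the map has #|crossing| vertices and twice as many edges,
   and each of its pieces has genus 0 (a circle being a piece with two sides). *)
Definition planar (D : diagram_code) : Prop :=
  #|region D| = (#|crossing D| + 2 * n_comp (@dart_adjacent D) (dart D))%N.

Record link_diagram := LinkDiagram {
  code :> diagram_code;
  planarP : planar code }.

Definition connected_diagram (D : link_diagram) : Prop :=
  inhabited (dart D) /\ forall d d' : dart D, connect (@dart_adjacent D) d d'.

Definition alternating (D : link_diagram) : Prop :=
  forall h : crossing D * 'I_4, over_half (mate h) = ~~ over_half h.

(* With both strands upward, the crossing is positive iff the overstrand ends
   at the upper right, i.e. iff the outgoing under half-edge comes right after
   the outgoing over half-edge in counter-clockwise order. *)
Definition positive_crossing (D : diagram_code) (c : crossing D) : bool :=
  [exists i : 'I_4, [&& over_half (c, i), outgoing (c, i)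
                      & outgoing (c, ordS i)]].

(* When the overstrand runs from lower left to upper right, the top and bottom
   corners are those following its half-edges in counter-clockwise order. *)
Record shading (D : link_diagram) := Shading {
  shaded : {set region D};
  shaded_flip : forall d : dart D,
    (left_region (flip d) \in shaded) = (left_region d \notin shaded);
  shaded_crossing : forall (c : crossing D) (i : 'I_4),
    (left_region (inl (c, i)) \in shaded) = over_half (c, i) }.

(** * Plane digraphs

  Only the incidences used by the activities are recorded.  [incident r q] means
  that the boundary of the face [q] contains the vertex [r]. *)

Record plane_digraph := PlaneDigraph {
  vertex : finType;
  edge : finType;
  face : finType;
  tail : edge -> vertex;
  head : edge -> vertex;
  left_face : edge -> face;
  right_face : edge -> face;
  incident : vertex -> face -> bool;
  positive : pred edge }.

(** * The Tait digraph *)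

Section Tait.
Variables (D : link_diagram) (S : shading D).
Implicit Type c : crossing D.

Definition over_out c : 'I_4 := if outgoing (c, 1) then 1 else 3%:R.

Lemma over_out_odd c : odd (over_out c).
Proof. by rewrite /over_out; case: ifP. Qed.

Lemma odd_ordS (i : 'I_4) : odd (ordS i) = ~~ odd i.
Proof. by case: i => [[|[|[|[|]]]]]. Qed.

Definition tait_vertex : finType := {R : region D | R \in shaded S}.
Definition tait_face : finType := {R : region D | R \notin shaded S}.

Lemma vertex_at_subproof c (i : 'I_4) :
  odd i -> left_region (inl (c, i)) \in shaded S.
Proof. by rewrite shaded_crossing. Qed.

Definition vertex_at c (i : 'I_4) (oi : odd i) : tait_vertex :=
  exist _ (left_region (inl (c, i))) (vertex_at_subproof c oi).

Lemma face_at_subproof c (i : 'I_4) :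
  ~~ odd i -> left_region (inl (c, i)) \notin shaded S.
Proof. by rewrite shaded_crossing. Qed.

Definition face_at c (i : 'I_4) (ei : ~~ odd i) : tait_face :=
  exist _ (left_region (inl (c, i))) (face_at_subproof c ei).

Lemma bottom_odd c : odd (ordS (ordS (over_out c))).
Proof. by rewrite !odd_ordS over_out_odd. Qed.

Lemma left_even c : ~~ odd (ordS (over_out c)).
Proof. by rewrite odd_ordS over_out_odd. Qed.

Lemma right_even c : ~~ odd (ord_pred (over_out c)).
Proof. by rewrite -odd_ordS ord_predK over_out_odd. Qed.

(* With the overstrand directed from lower left to upper right, [over_out c] is
   the upper right half-edge; the corners following it in counter-clockwise
   order are top, left, bottom, right.  The faces of the Tait digraph are
   identified with the unshaded regions. *)
Definition tait_digraph : plane_digraph := {|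
  vertex := tait_vertex;
  edge := crossing D;
  face := tait_face;
  tail := fun c => vertex_at c (bottom_odd c);
  head := fun c => vertex_at c (over_out_odd c);
  left_face := fun c => face_at c (left_even c);
  right_face := fun c => face_at c (right_even c);
  incident := fun r q =>
    [exists d, (left_region d == sval r) && (left_region (flip d) == sval q)];
  positive := @positive_crossing D |}.

End Tait.

(** * Spanning trees and activities *)

Section Activities.
Variable G : plane_digraph.
Implicit Types (A T C : {set edge G}) (e : edge G).

Definition joined A : rel (vertex G) :=
  connect (fun u v => [exists e in A,
    ((tail e == u) && (head e == v)) || ((head e == u) && (tail e == v))]).

Definition degree A (v : vertex G) : nat :=
  (#|[set e in A | tail e == v]| + #|[set e in A | head e == v]|)%N.

(* Connected and 2-regular; a loop counts twice in [degree]. *)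
Definition is_cycle C : bool :=
  [&& C != set0, [forall v, (degree C v == 0%N) || (degree C v == 2%N)]
    & [forall e in C, forall e' in C, joined C (tail e) (tail e')]].

Definition spanning_tree T : bool :=
  [forall u, forall v, joined T u v]
  && [forall C : {set edge G}, (C \subset T) ==> ~~ is_cycle C].

Definition internally_active T (r : vertex G) e : bool :=
  joined (T :\ e) r (tail e).

Definition Cyc T e : {set edge G} :=
  odflt set0 [pick C : {set edge G} | is_cycle C && (C \subset e |: T)].

(* The components of the complement of [A] in the sphere: faces are glued
   along the edges that are not in [A]. *)
Definition same_side A : rel (face G) :=
  connect (fun f g => [exists e in ~: A,
    ((left_face e == f) && (right_face e == g))
    || ((right_face e == f) && (left_face e == g))]).

(* [(e, true)] is the edge [e] with its own direction, [(e, false)] the reverse. *)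
Definition left_of (a : edge G * bool) : face G :=
  if a.2 then left_face a.1 else right_face a.1.

(* [Cyc T e] oriented so that the side containing [q] lies on its left. *)
Definition ccw_Cyc T (q : face G) e : {set edge G * bool} :=
  [set a | (a.1 \in Cyc T e) && same_side (Cyc T e) q (left_of a)].

Definition externally_active T (q : face G) e : bool :=
  (e, true) \in ccw_Cyc T q e.

Variables (r : vertex G) (q : face G).

Definition iota_pos T : nat :=
  #|[set e in T | positive e && internally_active T r e]|.
Definition iota_bar_pos T : nat :=
  #|[set e in T | positive e && ~~ internally_active T r e]|.
Definition eps_neg T : nat :=
  #|[set e in ~: T | ~~ positive e && externally_active T q e]|.
Definition eps_bar_neg T : nat :=
  #|[set e in ~: T | ~~ positive e && ~~ externally_active T q e]|.

(* The ring Z[x^-1, y^-1, z, w] is the polynomial ring on the generators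
   x^-1, y^-1, z, w, which are the variables number 0, 1, 2, 3. *)
Definition tree_polynomial : {mpoly int[4]} :=
  \sum_(T : {set edge G} | spanning_tree T)
    'X_0 ^+ iota_pos T * 'X_1 ^+ iota_bar_pos T
    * 'X_(2%:R) ^+ eps_neg T * 'X_(3%:R) ^+ eps_bar_neg T.

End Activities.

Definition P_ (D : link_diagram) (S : shading D)
    (r : vertex (tait_digraph S)) (q : face (tait_digraph S)) :
    {mpoly int[4]} :=
  tree_polynomial r q.

(* Substitution of [a, b, c, d] for x^-1, y^-1, z, w. *)
Definition subst4 (P a b c d : {mpoly int[4]}) : {mpoly int[4]} :=
  P \mPo [tuple a; b; c; d].

Definition xinv : {mpoly int[4]} := 'X_0.
Definition yinv : {mpoly int[4]} := 'X_1.
Definition zvar : {mpoly int[4]} := 'X_(2%:R).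
Definition wvar : {mpoly int[4]} := 'X_(3%:R).

(* Main.v *)
(* Weight a spanning tree by x or y for each positive edge pointing away from or
   towards the root.  By the matrix-tree theorem, proved here by expanding
   det(M B^T) over maps sending each vertex to an edge at it, the weighted sum
   is the determinant of a Laplacian.  Exchanging x and y transposes this
   Laplacian as soon as every vertex has as many incoming as outgoing positive
   edges.  In the Tait digraph this holds because the orientation of the link
   along the boundary of a shaded region changes exactly at the positive
   crossings, alternately in the two senses.

   For the external activities, pass to the dual digraph: complements of
   spanning trees are spanning trees of the dual, an edge outside T is
   externally active iff it is internally active in the dual tree, and at the
   unshaded regions it is the negative edges that are balanced. *)
Require Import Defs.
From mathcomp Require Import all_boot all_order all_algebra all_fingroup.
From mathcomp Require Import zify ring.
Set Implicit Arguments.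
Unset Strict Implicit.
Unset Printing Implicit Defensive.
Import GRing.Theory.
Local Open Scope ring_scope.

(* [head] would otherwise be the one of sequences. *)
Local Notation head := Defs.head.

(** * Spanning trees as parent maps *)

Section Trees.
Variable G : plane_digraph.
Implicit Types (A B C T : {set edge G}) (e : edge G) (u v w r : vertex G).

Definition adjacent A : rel (vertex G) :=
  fun u v => [exists e in A,
    ((tail e == u) && (head e == v)) || ((head e == u) && (tail e == v))].

Lemma adjacent_sym A : symmetric (adjacent A).
Proof.
by move=> u v; apply/exists_inP/exists_inP => -[e eA h]; exists e => //;
   rewrite orbC [X in X || _]andbC [X in _ || X]andbC.
Qed.

Lemma joined_sym A : symmetric (joined A).
Proof. exact: sym_connect_sym (adjacent_sym A). Qed.

Lemma joined_refl A v : joined A v v.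
Proof. exact: connect0. Qed.

Lemma joined_trans A : transitive (joined A).
Proof. exact: connect_trans. Qed.

Lemma joined_edge A e : e \in A -> joined A (tail e) (head e).
Proof. by move=> eA; apply/connect1/exists_inP; exists e; rewrite ?eqxx. Qed.

Lemma joined_ind A (R : rel (vertex G)) :
    reflexive R -> transitive R -> symmetric R ->
    {in A, forall e, R (tail e) (head e)} ->
  forall u v, joined A u v -> R u v.
Proof.
move=> R0 Rt Rs RA u v /connectP[p + ->]; elim: p u => //= w p IH u.
case/andP=> /exists_inP[e eA h] /IH; apply: Rt.
by case/orP: h => /andP[/eqP <- /eqP <-]; [|rewrite Rs]; apply: RA.
Qed.

Lemma joined_sub A B :
    {in A, forall e, joined B (tail e) (head e)} ->
  forall u v, joined A u v -> joined B u v.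
Proof.
exact: joined_ind (joined_refl B) (@joined_trans B) (joined_sym B).
Qed.

Lemma joinedS A B u v : A \subset B -> joined A u v -> joined B u v.
Proof.
by move=> /subsetP sAB; apply: joined_sub => e /sAB; apply: joined_edge.
Qed.

(** * Degrees, simple paths and cycles *)

Lemma degreeU1 A e v : e \notin A ->
  degree (e |: A) v = (degree A v + (tail e == v) + (head e == v))%N.
Proof.
move=> eA.
have cardU (P : pred (edge G)) :
    #|[set x in e |: A | P x]| = (P e + #|[set x in A | P x]|)%N.
  rewrite -!sum1dep_card (bigID (pred1 e)) /=; congr (_ + _)%N.
    rewrite (eq_bigl (fun x => (x == e) && P x)); last first.
      by move=> x; rewrite !inE; case: (x == e); rewrite ?andbF ?andbT.
    by rewrite big_mkcondr big_pred1_eq; case: (P e).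
  apply: eq_bigl => x; rewrite !inE; case: eqVneq => [->|_] /=.
    by rewrite (negPf eA) /= andbF.
  by rewrite andbT.
rewrite /degree !cardU; lia.
Qed.

Definition endpoint e v := (tail e == v) || (head e == v).

Lemma degree_gt0 A v : (0 < degree A v)%N = [exists e in A, endpoint e v].
Proof.
rewrite addn_gt0 !card_gt0; apply/orP/exists_inP => [[]|[e eA /orP[] h]].
- by case/set0Pn=> e; rewrite inE => /andP[eA h]; exists e; rewrite ?/endpoint ?h.
- by case/set0Pn=> e; rewrite inE => /andP[eA h]; exists e;
     rewrite ?/endpoint ?h ?orbT.
- by left; apply/set0Pn; exists e; rewrite inE eA.
- by right; apply/set0Pn; exists e; rewrite inE eA.
Qed.

Lemma degree0 v : degree set0 v = 0%N.
Proof.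
by apply/eqP; rewrite addn_eq0 !cards_eq0 -!subset0;
   apply/andP; split; apply/subsetP => e; rewrite !inE.
Qed.

(** An interior vertex of a simple path has degree 2 and an end has degree 1; adding the ends on the
    left-hand side also covers the empty path, whose only vertex has degree 0. *)
Lemma simple_path_edges A u p : path (adjacent A) u p -> uniq (u :: p) ->
  exists B, [/\ B \subset A, {in B, forall e, joined B u (tail e)} &
    forall v, (degree B v + (v == u) + (v == last u p) = 2 * (v \in u :: p))%N].
Proof.
elim: p u => [|w p IH] u.
  move=> _ _; exists set0; split=> [|e|v]; rewrite ?sub0set ?inE //.
  by rewrite degree0 /=; case: eqP.
case/andP=> /exists_inP[e eA ends] pth /andP[u_p uniq_p].
have [B [sBA conB degB]] := IH w pth uniq_p.
have ends_e : (tail e == u) && (head e == w) || (tail e == w) && (head e == u).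
  by rewrite [X in _ || X]andbC.
(* As [u] is off the rest of the path, [degB] gives it degree 0 in [B], while [e] ends at [u]. *)
have eB : e \notin B.
  apply/negP => eB; have := degB u; rewrite (negPf u_p).
  have : (0 < degree B u)%N.
    rewrite degree_gt0; apply/exists_inP; exists e => //.
    by case/orP: ends => /andP[h _]; rewrite /endpoint h ?orbT.
  by rewrite lt0n => deg_u /eqP; rewrite muln0 -addnA addn_eq0 (negPf deg_u).
have juw : joined (e |: B) u w.
  by apply/connect1/exists_inP; exists e; rewrite ?setU11.
exists (e |: B); split=> [|e'|v].
- by rewrite subUset sub1set eA.
- case/setU1P=> [->|e'B].
    by case/orP: ends_e => /andP[/eqP -> _]; rewrite ?joined_refl.
  by apply: joined_trans juw (joinedS _ (conB _ e'B)); apply: subsetUr.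
- have ends_v : ((tail e == v) + (head e == v) = (v == u) + (v == w))%N.
    by case/orP: ends_e => /andP[/eqP-> /eqP->]; rewrite ![_ == v]eq_sym 1?addnC.
  rewrite degreeU1 // -[X in (X + _ + _)%N]addnA ends_v last_cons in_cons.
  have := degB v; case: (eqVneq v u) => [->|_]; first rewrite (negPf u_p).
    by move: (u == w) (u == last w p) => [] []; clear; lia.
  by move: (v == w) (v == last w p) (v \in w :: p) => [] [] []; clear; lia.
Qed.

(** A simple path from [tail e] to [head e] is closed up by [e], which supplies the missing degree
    at both ends; if [e] is a loop, the path is empty. *)
Lemma joined_cycle A e : e \notin A -> joined A (tail e) (head e) ->
  exists2 C, is_cycle C & C \subset e |: A.
Proof.
move=> eA /connectP[p0 pth0]; case/shortenP: pth0 => p pth uniq_p _ last_p.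
have [B [sBA conB degB]] := simple_path_edges pth uniq_p.
have eB : e \notin B by apply: contra eA => /(subsetP sBA).
exists (e |: B); last exact: setUS.
apply/and3P; split.
- by apply/set0Pn; exists e; rewrite setU11.
- apply/forallP => v; have := degB v.
  rewrite -last_p degreeU1 // ![v == _]eq_sym => ->.
  by case: (_ \in _).
- have conC e' : e' \in e |: B -> joined (e |: B) (tail e) (tail e').
    case/setU1P=> [->|e'B]; first exact: joined_refl.
    exact: joinedS (subsetUr _ _) (conB _ e'B).
  apply/forall_inP => e1 e1C; apply/forall_inP => e2 e2C.
  by apply: joined_trans (conC _ e2C); rewrite joined_sym conC.
Qed.

(** For a loop this is [v] itself, so a parent edge, which lowers the depth, is never a loop. *)
Definition opposite e v := if tail e == v then head e else tail e.

Lemma joined_opposite A e v : endpoint e v -> e \in A -> joined A v (opposite e v).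
Proof.
rewrite /endpoint /opposite => ev /joined_edge.
by case: eqP ev => [<-//|_] /eqP<-; rewrite joined_sym.
Qed.

Lemma opposite_ends e v w : endpoint e v -> endpoint e w -> w != v ->
  opposite e v = w.
Proof.
rewrite /endpoint /opposite; case: (eqVneq (tail e) v) => [->|_] /=.
  by move=> _ /orP[/eqP-> /eqP//|/eqP].
by move=> /eqP-> /orP[/eqP|/eqP->/eqP].
Qed.

(* The edge from each vertex to its parent in a tree rooted at [r]; [d] bounds
   the depth. *)
Definition parent_map r (f : vertex G -> option (edge G)) (d : vertex G -> nat) :=
  f r = None /\ forall v, v != r ->
    exists2 e, f v = Some e & endpoint e v /\ (d (opposite e v) < d v)%N.

Definition parent_edges (f : vertex G -> option (edge G)) : {set edge G} :=
  [set e | [exists v, f v == Some e]].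

Definition connected A := forall u v, joined A u v.

(* The parent of a vertex is the next vertex on a shortest path to [r]. *)
Lemma connected_parent_map A r : connected A ->
  exists f d, parent_map r f d /\ parent_edges f \subset A.
Proof.
move=> conA.
pose reach v k := [exists t : k.-tuple (vertex G),
  path (adjacent A) v t && (last v t == r)].
have reachP v : exists k, reach v k.
  have /connectP[p pth lp] := conA v r.
  by exists (size p); apply/existsP; exists (in_tuple p); rewrite pth lp eqxx.
pose d v := ex_minn (reachP v).
have dP v : reach v (d v) by rewrite /d; case: ex_minnP.
have d_min v k : reach v k -> (d v <= k)%N.
  by rewrite /d; case: ex_minnP => m _; apply.
pose good v e := [&& e \in A, endpoint e v & (d (opposite e v) < d v)%N].
pose f v := if v == r then None else [pick e | good v e].
have fP v : v != r -> exists2 e, f v = Some e & good v e.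
  move=> vr; rewrite /f (negPf vr); case: pickP => [e ge|no]; first by exists e.
  suff [e ge] : exists e, good v e by rewrite no in ge.
  have /existsP[[[|w p] /= /eqP sp]] := dP v; first by rewrite /= (negPf vr).
  case/andP=> /andP[/exists_inP[e eA ends] pth] lp.
  have dw : (d w < d v)%N.
    rewrite -sp ltnS; apply: d_min.
    by apply/existsP; exists (in_tuple p); rewrite pth.
  have vw : w != v by apply: contraTneq dw => ->; rewrite ltnn.
  have ev : endpoint e v.
    by case/orP: ends => /andP[h _]; rewrite /endpoint h ?orbT.
  have ew : endpoint e w.
    by case/orP: ends => /andP[_ h]; rewrite /endpoint h ?orbT.
  by exists e; rewrite /good eA ev (opposite_ends ev ew vw).
exists f, d; split; first split=> [|v vr]; first by rewrite /f eqxx.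
  by have [e fe /and3P[_ ev de]] := fP v vr; exists e.
apply/subsetP => e; rewrite inE => /existsP[v /eqP fe].
have [vr|vr] := eqVneq v r; first by rewrite /f vr eqxx in fe.
by have [e' + /and3P[eA _ _]] := fP v vr; rewrite fe => -[->].
Qed.

Lemma spanning_treeP T :
  reflect (connected T /\ forall C, is_cycle C -> ~~ (C \subset T))
          (spanning_tree T).
Proof.
apply: (iffP andP) => [[conT /forallP acT]|[conT acT]]; split.
- by move=> u v; have /forallP/(_ v) := forallP conT u.
- by move=> C cycC; have := acT C; rewrite cycC implybF.
- by apply/forallP => u; apply/forallP => v; apply: conT.
- by apply/forallP => C; apply/implyP; apply: contraL => /acT.
Qed.

(** * Trees given by parent maps *)

Section ParentMap.
Variables (r : vertex G) (f : vertex G -> option (edge G)) (d : vertex G -> nat).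
Hypothesis fP : parent_map r f d.
Local Notation T := (parent_edges f).

Lemma parent_map_root : f r = None. Proof. by case: fP. Qed.

Lemma parent_map_edge v e : f v = Some e ->
  [/\ e \in T, endpoint e v, opposite e v != v & (d (opposite e v) < d v)%N].
Proof.
case: fP => fr fV fv; have vr : v != r by apply: contra_eq_neq fv => ->; rewrite fr.
have [e' + [ev de]] := fV v vr; rewrite fv => -[eq_e]; subst e'.
split=> //; first by rewrite inE; apply/existsP; exists v; rewrite fv.
by apply: contraTneq de => ->; rewrite ltnn.
Qed.

Lemma parent_edgesP e : reflect (exists v, f v = Some e) (e \in T).
Proof.
rewrite inE; apply: (iffP existsP) => -[v fv]; exists v; [exact/eqP|].
by rewrite fv.
Qed.

(** Two vertices with a common parent edge would be opposite ends of it, each of smaller depth than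
    the other; the value [None] occurs only at the root. *)
Lemma parent_map_inj : injective f.
Proof.
move=> v w; case fv: (f v) => [e|] fw; last first.
  case: fP => _ fV; have [->|vr] := eqVneq v r; last first.
    by have [e] := fV v vr; rewrite fv.
  by have [->//|wr] := eqVneq w r; have [e] := fV w wr; rewrite -fw.
have [_ ev _ dv] := parent_map_edge fv.
have [_ ew _ dw] := parent_map_edge (esym fw).
apply/eqP; apply/negPn/negP => vw.
move: dv dw; rewrite (opposite_ends ew ev vw) (opposite_ends ev ew) 1?eq_sym //.
by move=> /ltnW; rewrite leqNgt => /negPf->.
Qed.

(** [f] is a bijection from the vertices onto [None] together with the edges in [T]. *)
Lemma card_parent_edges : #|T|.+1 = #|vertex G|.
Proof.
rewrite -cardsT -(card_imset setT parent_map_inj).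
have -> : f @: setT = None |: (Some @: T).
  apply/setP => o; apply/imsetP/setU1P => [[v _ ->]|[->|/imsetP[e eT ->]]].
  - case fv: (f v) => [e|]; [right | by left].
    by apply/imset_f; case: (parent_map_edge fv).
  - by exists r; rewrite ?parent_map_root.
  - by have /parent_edgesP[v fv] := eT; exists v; rewrite ?fv.
rewrite cardsU1 card_imset; last by move=> ? ? [].
by case: imsetP => // -[].
Qed.

(* Walking up the tree only uses parent edges of vertices of lower depth. *)
Lemma joined_root A v :
    (forall w e, (d w <= d v)%N -> f w = Some e -> e \in A) ->
  joined A v r.
Proof.
have [n] := ubnP (d v); elim: n v => // n IH v /ltnSE le_dv sA.
have [->|vr] := eqVneq v r; first exact: joined_refl.
case: fP => _ /(_ v vr)[e fv _].
have [_ ev _ dv] := parent_map_edge fv.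
apply: joined_trans (joined_opposite ev (sA v e (leqnn _) fv)) _.
apply: IH (leq_trans dv le_dv) _ => w e' dw; apply: sA.
exact: leq_trans dw (ltnW dv).
Qed.

Lemma parent_edges_connected : connected T.
Proof.
have jr v : joined T v r.
  by apply: joined_root => w e _ /parent_map_edge[].
by move=> u v; apply: joined_trans (jr u) _; rewrite joined_sym.
Qed.

(** Among the vertices whose parent edge lies in [C], take one of maximal depth: any further edge of
    [C] there would be the parent edge of a deeper vertex. *)
Lemma parent_edges_leaf C : C \subset T -> C != set0 ->
  exists v, degree C v = 1%N.
Proof.
move=> /subsetP sCT /set0Pn[e0 e0C].
have /parent_edgesP[v0 fv0] := sCT _ e0C.
pose inC v := if f v is Some e then e \in C else false.
have inCv0 : inC v0 by rewrite /inC fv0.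
case: (arg_maxnP d inCv0) => v; rewrite /inC.
case fv: (f v) => [e|//] eC maxv.
have [_ ev ov _] := parent_map_edge fv.
exists v; rewrite -(setD1K eC) degreeU1 ?setD11 //.
have -> : degree (C :\ e) v = 0%N.
  apply/eqP; rewrite -leqn0 leqNgt degree_gt0; apply/exists_inP.
  move=> [e' /setD1P[e'e e'C] e'v].
  have /parent_edgesP[w fw] := sCT _ e'C.
  have [_ e'w _ dw] := parent_map_edge fw.
  have vw : v != w.
    by apply: contraNneq e'e => vw; move: fw; rewrite -vw fv => -[->].
  move: dw; rewrite (opposite_ends e'w e'v vw) ltnNge => /negP; apply.
  by apply: maxv; rewrite fw.
move: ev ov; rewrite /endpoint /opposite.
by case: (eqVneq (tail e) v) => [_ _ /negPf->|_ /= ->].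
Qed.

Lemma parent_edges_acyclic C : is_cycle C -> ~~ (C \subset T).
Proof.
case/and3P=> C0 /forallP degC _; apply/negP => sCT.
by have [v dv] := parent_edges_leaf sCT C0; have := degC v; rewrite dv.
Qed.

Lemma parent_edges_tree : spanning_tree T.
Proof.
by apply/spanning_treeP; split;
  [apply: parent_edges_connected | apply: parent_edges_acyclic].
Qed.

Lemma acyclic_joined T' e : (forall C, is_cycle C -> ~~ (C \subset T')) ->
  e \in T' -> ~~ joined (T' :\ e) (tail e) (head e).
Proof.
move=> acT eT; apply/negP => /joined_cycle[|C cycC]; first by rewrite setD11.
by rewrite setD1K //; apply/negP/acT.
Qed.

(** Walking up from the parent of [v] never uses [e], the depths being too small; if [v] were also
    reached, [e] would close a cycle. *)
Lemma joined_parent v e : f v = Some e ->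
  joined (T :\ e) r (opposite e v) /\ ~~ joined (T :\ e) r v.
Proof.
move=> fv; have [eT ev _ dv] := parent_map_edge fv.
have jo : joined (T :\ e) r (opposite e v).
  rewrite joined_sym; apply: joined_root => w e' dw fw.
  have [e'T _ _ _] := parent_map_edge fw; rewrite in_setD1 e'T andbT.
  apply: contraTneq (leq_ltn_trans dw dv) => ee.
  by rewrite (@parent_map_inj w v) ?ltnn // fv fw ee.
split=> //; apply/negP => jv.
have /negP[] := acyclic_joined parent_edges_acyclic eT.
have jov : joined (T :\ e) (opposite e v) v.
  by apply: joined_trans jv; rewrite joined_sym.
move: ev jov; rewrite /endpoint /opposite.
by case: eqP => [<- _|_ /= /eqP<-//]; rewrite joined_sym.
Qed.

End ParentMap.

(** Shortest paths inside [T] give a parent map whose edges already connect everything, so any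
    further edge of [T] would close a cycle. *)
Lemma tree_parent_map T r : spanning_tree T ->
  exists f d, parent_map r f d /\ parent_edges f = T.
Proof.
case/spanning_treeP=> conT acT.
have [f [d [fP sfT]]] := connected_parent_map r conT.
exists f, d; split=> //; apply/eqP; rewrite eqEsubset sfT.
apply/subsetP => e eT; apply/negPn/negP => ef.
have /negP[] := acyclic_joined acT eT.
apply: joinedS (parent_edges_connected fP _ _).
by apply/subsetP => e' e'f; rewrite !inE (subsetP sfT) // andbT;
   apply: contraNneq ef => <-.
Qed.

End Trees.

(** * The matrix-tree theorem *)

Lemma big_ord_enum (R : Type) (idx : R) (op : Monoid.com_law idx) (V : finType)
    (F : V -> R) :
  \big[op/idx]_v F v = \big[op/idx]_(i < #|V|) F (enum_val i).
Proof. by rewrite (reindex (@enum_val V V)) //; apply/onW_bij/enum_val_bij. Qed.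

Lemma sum_option (R : nmodType) (I : finType) (F : option I -> R) :
  \sum_o F o = F None + \sum_i F (Some i).
Proof.
rewrite (bigD1 None) //=; congr (_ + _).
rewrite (reindex_omap Some id) => [|[i|]] //=.
by apply: eq_bigl => i; rewrite eqxx.
Qed.

(** Multilinearity in the rows: [f] selects one summand [o] in each row. This is the Cauchy-Binet
    formula before terms with the same image are collected. *)
Lemma det_sum_mul (R : comNzRingType) (V O : finType) (A B : V -> O -> R) :
  \det (\matrix_(i < #|V|, j < #|V|)
          \sum_o A (enum_val i) o * B (enum_val j) o)
  = \sum_(f : {ffun V -> O}) (\prod_v A v (f v))
      * \det (\matrix_(i < #|V|, j < #|V|) B (enum_val j) (f (enum_val i))).
Proof.
pose t (f : {ffun V -> O}) (s : 'S_#|V|) := (\prod_v A v (f v)) *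
   ((-1) ^+ s * \prod_(i < #|V|) B (enum_val (s i)) (f (enum_val i))).
transitivity (\sum_s \sum_f t f s); last first.
  rewrite exchange_big; apply: eq_bigr => f _; rewrite -mulr_sumr.
  congr (_ * _); apply: eq_bigr => s _; congr (_ * _).
  by apply: eq_bigr => i _; rewrite mxE.
apply: eq_bigr => s _.
transitivity ((-1) ^+ s * \prod_v \sum_o A v o * B (enum_val (s (enum_rank v))) o).
  congr (_ * _); rewrite [RHS]big_ord_enum; apply: eq_bigr => i _.
  by rewrite mxE enum_valK.
rewrite bigA_distr_bigA /= mulr_sumr; apply: eq_bigr => f _.
rewrite big_split /= [X in _ * (_ * X)]big_ord_enum mulrCA; congr (_ * (_ * _)).
by apply: eq_bigr => i _; rewrite enum_valK.
Qed.

Section MatrixTree.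
Variables (R : idomainType) (G : plane_digraph) (r : vertex G).
Implicit Types (a b : edge G -> R) (v : vertex G) (T : {set edge G}).

(* [None] is an additional edge entering the root from outside the graph. *)
Definition weighted_incidence a b v (o : option (edge G)) : R :=
  if o is Some e then a e *+ (head e == v) - b e *+ (tail e == v)
  else (v == r)%:R.

Local Notation incidence := (weighted_incidence (fun=> 1) (fun=> 1)).

(** The edge [None] adds 1 to the diagonal entry at [r]. Without it the rows sum to zero, so the
    determinant is the minor of the directed Laplacian with row and column [r] removed. *)
Definition laplacian a b : 'M[R]_#|vertex G| :=
  \matrix_(i, j) \sum_o weighted_incidence a b (enum_val i) o
                        * incidence (enum_val j) o.

Definition incidence_mx (f : vertex G -> option (edge G)) : 'M[R]_#|vertex G| :=
  \matrix_(i, j) incidence (enum_val j) (f (enum_val i)).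

Lemma incidence_endpoint a b v e :
  weighted_incidence a b v (Some e) != 0 -> endpoint e v.
Proof.
rewrite /endpoint /=; case: (tail e == v); case: (head e == v) => //.
by rewrite !mulr0n subr0 eqxx.
Qed.

(** Triangularity: a nonzero term of the expansion sends each vertex to itself or to its parent,
    which lowers the depth; since a permutation preserves the sum of the depths, only the identity
    survives. *)
Lemma det_incidence_parent_map f d : parent_map r f d ->
  \det (incidence_mx f) = \prod_v incidence v (f v).
Proof.
move=> fP; rewrite /determinant (bigD1 1%g) //= odd_perm1 expr0 mul1r.
rewrite [X in _ + X]big1 ?addr0 => [|s s1].
  by rewrite [RHS]big_ord_enum; apply: eq_bigr => i _; rewrite mxE perm1.
pose dv (i : 'I_#|vertex G|) := d (enum_val i).
have le_dv : ~~ [forall i, incidence_mx f i (s i) != 0].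
  apply: contra s1 => /forallP nz.
  have ds i : s i = i \/ (dv (s i) < dv i)%N.
    have := nz i; rewrite mxE; case fi: (f _) => [e|]; last first.
      case: (eqVneq (enum_val (s i)) r) => /= [si _|/negPf->]; last by rewrite eqxx.
      left; apply: enum_val_inj.
      rewrite si; apply: (parent_map_inj fP).
      by rewrite fi (parent_map_root fP).
    move=> /incidence_endpoint es; have [_ ei _ de] := parent_map_edge fP fi.
    have [/enum_val_inj->|ne] := eqVneq (enum_val (s i)) (enum_val i).
      by left.
    by right; rewrite /dv -(opposite_ends ei es ne).
  apply/eqP/permP => i; rewrite perm1; case: (ds i) => // lt_i; exfalso.
  have : (\sum_j dv (s j) < \sum_j dv j)%N.
    rewrite (bigD1 i) // [X in (_ < X)%N](bigD1 i) //= -addSn leq_add //.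
    by apply: leq_sum => j _; case: (ds j) => [->|/ltnW].
  by rewrite [X in (_ < X)%N](reindex_inj (@perm_inj _ s)) ltnn.
have /forallPn[i /negPn/eqP z] := le_dv.
by rewrite (bigD1 i) //= z mul0r mulr0.
Qed.

(** The first factor makes each [f v] an edge at [v], with [None] possible only at [r]. The
    determinant makes the walk along [next] reach [r] from every vertex, and the number of steps is
    the depth. *)
Lemma parent_map_of_det a b (f : vertex G -> option (edge G)) :
    (\prod_v weighted_incidence a b v (f v)) * \det (incidence_mx f) != 0 ->
  exists d, parent_map r f d.
Proof.
rewrite mulf_eq0 negb_or => /andP[/prodf_neq0 fnz det_nz].
have f_end v e : f v = Some e -> endpoint e v.
  by move=> fv; apply: (@incidence_endpoint a b); rewrite -fv fnz.
have f_root v : f v = None -> v = r.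
  move=> fv; have := fnz v isT; rewrite fv /=.
  by case: (eqVneq v r) => // _; rewrite eqxx.
pose next v := if f v is Some e then opposite e v else v.
pose out v := [exists w, fconnect next v w && (f w == None)].
have out_next v : out (next v) = out v.
  apply/existsP/existsP => -[w /andP[vw fw]]; exists w; rewrite fw andbT.
    exact: connect_trans (fconnect1 _ _) vw.
  have /iter_findex := vw; case: findex => [vw'|n]; last first.
    by rewrite iterSr => <-; apply: fconnect_iter.
  by rewrite /= in vw'; subst w; rewrite /next (eqP fw) connect0.
have all_out v : out v.
  (* The vertices that never leave the graph would span a kernel vector. *)
  case: (boolP (out v)) => // vX; case/negP: det_nz; rewrite -det_tr; apply/det0P.
  exists (\row_j (~~ out (enum_val j))%:R).
    apply/eqP => /rowP/(_ (enum_rank v)); rewrite !mxE enum_rankK vX.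
    by apply/eqP; rewrite oner_eq0.
  apply/rowP => i; rewrite !mxE.
  set u := enum_val i.
  transitivity (\sum_w (~~ out w)%:R * incidence w (f u)).
    by rewrite [RHS]big_ord_enum; apply: eq_bigr => j _; rewrite !mxE.
  case fu: (f u) => [e|] /=; last first.
    rewrite (bigD1 r) //= big1 ?addr0; last first.
      by move=> w /negPf->; rewrite mulr0.
    suff -> : out r by rewrite mul0r.
    by apply/existsP; exists u; rewrite fu eqxx (f_root u fu) connect0.
  (* The entry is a difference of indicators at the two ends of [f u]; these are [u] and [next u],
     where [out] agrees. *)
  have ->: \sum_w (~~ out w)%:R * ((head e == w)%:R - (tail e == w)%:R)
     = (~~ out (head e))%:R - (~~ out (tail e))%:R :> R.
    have sum1 (x : vertex G) : \sum_w (~~ out w)%:R * (x == w)%:R = (~~ out x)%:R :> R.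
      rewrite (bigD1 x) //= big1 ?eqxx ?mulr1 ?addr0 // => w wx.
      by rewrite eq_sym (negPf wx) mulr0.
    by under eq_bigr do rewrite mulrBr; rewrite sumrB !sum1.
  move: (f_end u e fu) (out_next u); rewrite /next fu /endpoint /opposite.
  by case: eqP => [-> _ ->|_ /= /eqP-> ->]; rewrite subrr.
have iter_r v : exists k, iter k next v == r.
  have /existsP[w /andP[/iter_findex vw /eqP/f_root wr]] := all_out v.
  by exists (findex next v w); rewrite vw wr.
have fr : f r = None.
  by have /existsP[w /andP[_ /eqP fw]] := all_out r; rewrite -{1}(f_root w fw).
exists (fun v => ex_minn (iter_r v)); split=> // v vr.
case fv: (f v) => [e|]; last by rewrite (f_root v fv) eqxx in vr.
exists e => //; split; first exact: f_end.
case: ex_minnP => k _ k_min; case: ex_minnP => -[|m]; first by rewrite /= (negPf vr).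
by rewrite iterSr /next fv -/next ltnS => /k_min.
Qed.

Definition tree_weight a b T : R :=
  \prod_(e in T) (if internally_active T r e then a e else b e).

(** For [e] in a tree [T], the end away from [r], whose parent edge is [e]. *)
Definition child T (e : edge G) := if internally_active T r e then head e else tail e.

(** Recovers a parent map from its set of edges, so that trees and parent maps correspond
    bijectively. *)
Definition parent T : {ffun vertex G -> option (edge G)} :=
  [ffun v => if v == r then None else [pick e in T | child T e == v]].

Lemma child_parent_map f d v e : parent_map r f d -> f v = Some e ->
  child (parent_edges f) e = v
  /\ internally_active (parent_edges f) r e = (tail e != v).
Proof.
move=> fP fv; have [eT ev ov _] := parent_map_edge fP fv.
have [jo jv] := joined_parent fP fv.
rewrite /child /internally_active; move: ev ov jo jv; rewrite /endpoint /opposite.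
by case: eqP => [<- _ _ _ /negPf->|_ /= /eqP<- _ ->].
Qed.

Lemma parent_of_edges (f : {ffun vertex G -> option (edge G)}) d :
  parent_map r f d -> parent (parent_edges f) = f.
Proof.
move=> fP; apply/ffunP => v; rewrite ffunE.
have [->|vr] := eqVneq v r; first by rewrite (parent_map_root fP).
have [_ /(_ v vr)[e fv _]] := fP.
case: pickP => [e' /andP[/parent_edgesP[w fw] /eqP cw]|/(_ e)].
  by rewrite -cw (child_parent_map fP fw).1.
have [eT _ _ _] := parent_map_edge fP fv.
by rewrite eT (child_parent_map fP fv).1 eqxx.
Qed.

(** A parent edge entering [v] gives [a e] times 1 and one leaving [v] gives [- b e] times [-1], so
    no sign remains; it points away from the root exactly when it enters [v]. *)
Lemma weight_parent_map a b f d : parent_map r f d ->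
  (\prod_v weighted_incidence a b v (f v)) * \det (incidence_mx f)
  = tree_weight a b (parent_edges f).
Proof.
move=> fP; rewrite (det_incidence_parent_map fP) -big_split /=.
pose F (o : option (edge G)) :=
  if o is Some e
  then if internally_active (parent_edges f) r e then a e else b e else 1.
transitivity (\prod_v F (f v)).
  apply: eq_bigr => v _; rewrite /F /=; case fv: (f v) => [e|] /=; last first.
    have -> : v = r by apply: (parent_map_inj fP); rewrite fv (parent_map_root fP).
    by rewrite eqxx mulr1.
  have [_ ev ov _] := parent_map_edge fP fv.
  rewrite (child_parent_map fP fv).2; move: ev ov; rewrite /endpoint /opposite.
  case: eqP => [_ _ /negPf->|_ /= -> _].
    by rewrite !mulr0n !mulr1n !sub0r mulrNN mulr1.
  by rewrite !mulr0n !mulr1n !subr0 mulr1.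
transitivity (\prod_(o in f @: setT) F o).
  rewrite big_imset /=; first by apply: eq_bigl => v; rewrite inE.
  by move=> v w _ _; apply: (parent_map_inj fP).
rewrite (bigID (fun o => o == None)) /= big1 ?mul1r; last first.
  by move=> o /andP[_ /eqP->].
transitivity (\prod_(o in Some @: parent_edges f) F o); last first.
  by rewrite big_imset // => ? ? _ _ [].
apply: eq_bigl => o; apply/andP/imsetP => [[/imsetP[v _ ->]]|[e eT ->]].
  case fv: (f v) => [e|//] _; exists e => //.
  by have [] := parent_map_edge fP fv.
by have /parent_edgesP[v fv] := eT; split=> //; apply/imsetP; exists v.
Qed.

(** By [parent_map_of_det] only parent maps contribute to the expansion, and [parent] puts the
    spanning trees in bijection with these. *)
Lemma matrix_tree a b :
  \det (laplacian a b) = \sum_(T | spanning_tree T) tree_weight a b T.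
Proof.
have treeP T : spanning_tree T -> exists d,
    parent_map r (parent T) d /\ parent_edges (parent T) = T.
  move=> treeT; have [f [d [fP eT]]] := tree_parent_map r treeT.
  have fP' : parent_map r (finfun f) d.
    case: fP => fr fV; split=> [|v vr]; first by rewrite ffunE.
    by have [e fv he] := fV v vr; exists e; rewrite ?ffunE.
  have eT' : parent_edges (finfun f) = T.
    by rewrite -eT; apply/setP => e; rewrite !inE; apply: eq_existsb => v; rewrite ffunE.
  by exists d; rewrite -eT' (parent_of_edges fP').
rewrite det_sum_mul.
rewrite (bigID (fun f => f \in [set parent T | T in [set T | spanning_tree T]])) /=.
rewrite [X in _ + X]big1 ?addr0 => [|f]; last first.
  apply: contraNeq => /parent_map_of_det[d fP].
  apply/imsetP; exists (parent_edges f); rewrite ?(parent_of_edges fP) // inE.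
  exact: parent_edges_tree fP.
rewrite big_imset /= => [|T T']; last first.
  rewrite !inE => /treeP[d [_ eT]] /treeP[d' [_ eT']] eq_p.
  by rewrite -eT eq_p eT'.
rewrite (eq_bigl _ _ (in_set _)); apply: eq_bigr => T /treeP[d [fP eT]].
by rewrite [LHS](weight_parent_map a b fP) eT.
Qed.

Definition balanced (c : edge G -> R) :=
  forall v, \sum_e (c e *+ (head e == v) - c e *+ (tail e == v)) = 0.

(** Entry [(u, v)] of [laplacian a b] minus entry [(v, u)] of [laplacian b a] vanishes off the
    diagonal; for [u = v] it is the net inflow of [a - b] at [u], zero by balance. *)
Lemma tree_weight_swap a b : balanced (fun e => a e - b e) ->
  \sum_(T | spanning_tree T) tree_weight a b T
  = \sum_(T | spanning_tree T) tree_weight b a T.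
Proof.
move=> bal; rewrite -!matrix_tree -[LHS]det_tr; congr (\det _).
apply/matrixP => i j; rewrite !mxE.
move: (enum_val i) (enum_val j) => u v.
rewrite !sum_option /= [X in X + _]mulrC; congr (_ + _).
apply/eqP; rewrite -subr_eq0 -sumrB; apply/eqP.
transitivity ((\sum_e ((a e - b e) *+ (head e == u) - (a e - b e) *+ (tail e == u)))
    * (u == v)%:R); last by rewrite bal mul0r.
rewrite mulr_suml; apply: eq_bigr => e _; have [<-|uv] := eqVneq u v.
  by case: (head e == u); case: (tail e == u); rewrite !(mulr0n, mulr1n); ring.
case: (eqVneq (head e) u) => [->|_]; case: (eqVneq (tail e) u) => [->|_];
  rewrite ?(negPf uv); (try case: (head e == v)); (try case: (tail e == v));
  rewrite !(mulr0n, mulr1n); ring.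
Qed.

End MatrixTree.

(** * Duality *)

(** The dual edge crosses from left to right. Its sides are recorded as seen from the back of the
    sphere, so that dualising twice restores all incidences by computation. *)
Definition dual (G : plane_digraph) : plane_digraph := {|
  vertex := face G;
  edge := edge G;
  face := vertex G;
  tail := @left_face G;
  head := @right_face G;
  left_face := @tail G;
  right_face := @head G;
  incident := fun f v => incident v f;
  positive := @positive G |}.

Definition cut (G : plane_digraph) (X : pred (vertex G)) : {set edge G} :=
  [set e | X (tail e) != X (head e)].

(** The boundary of a union of faces is a cycle modulo 2. Together with Euler's formula this stands
    in for the Jordan curve theorem. *)
Definition dual_cuts_even (G : plane_digraph) := forall (X : pred (face G)) v,
  ~~ odd (degree (cut (X : pred (vertex (dual G))) : {set edge G}) v).

Definition plane (G : plane_digraph) := [/\ connected [set: edge G],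
  connected [set: edge (dual G)], (#|vertex G| + #|face G| = #|edge G| + 2)%N,
  dual_cuts_even G & dual_cuts_even (dual G)].

Lemma plane_dual G : plane G -> plane (dual G).
Proof. by case=> ? ? euler ? ?; split; rewrite // addnC. Qed.

Lemma cut_nonempty (G : plane_digraph) (X : pred (vertex G)) u v :
  connected [set: edge G] -> X u != X v -> cut X != set0.
Proof.
move=> conG uv; apply: contraNneq uv => cut0.
apply: (joined_ind (R := fun u v => X u == X v) _ _ _ _ (conG u v)) => [x|x y z|x y|e _].
- exact: eqxx.
- by move=> /eqP->.
- exact: eq_sym.
by apply/eqP; have := in_set0 e; rewrite -cut0 inE => /negbT/negPn/eqP.
Qed.

Section Plane.
Variable G : plane_digraph.
Hypothesis planeG : plane G.
Let G' := dual G.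
Implicit Types (C T : {set edge G}) (e : edge G) (q : face G).

Lemma tree_leaf T C : spanning_tree T -> C \subset T -> C != set0 ->
  exists v, degree C v = 1%N.
Proof.
move=> treeT sCT /[dup] C0 /set0Pn[e _].
have [f [d [fP eT]]] := tree_parent_map (tail e) treeT.
by apply: (parent_edges_leaf fP) C0; rewrite eT.
Qed.

Lemma card_tree T (r : vertex G) : spanning_tree T -> #|T|.+1 = #|vertex G|.
Proof.
by move=> /(tree_parent_map r)[f [d [fP <-]]]; apply: card_parent_edges fP.
Qed.

(** Otherwise the cut around a dual component avoids [~: T], so it is a nonempty part of [T] and has
    a vertex of degree 1, against parity. *)
Lemma connected_cotree T : spanning_tree T -> connected (~: T : {set edge G'}).
Proof.
case: planeG => _ con' _ even _ treeT p q; apply/negPn/negP => npq.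
pose X : pred (vertex G') := joined (~: T : {set edge G'}) p.
have cut0 : (cut X : {set edge G}) != set0.
  by apply: (cut_nonempty (u := p) (v := q)) con' _; rewrite /X joined_refl (negPf npq).
have sXT : (cut X : {set edge G}) \subset T.
  apply/subsetP => e; rewrite inE; apply: contraR => eT; apply/eqP.
  have je : joined (~: T : {set edge G'}) (@tail G' e) (@head G' e).
    by apply: joined_edge; rewrite inE.
  apply/idP/idP => jp; apply: joined_trans jp _ => //.
  by rewrite joined_sym.
have [v deg1] := tree_leaf treeT sXT cut0.
by have := even X v; rewrite deg1.
Qed.
End Plane.

(** A dual spanning tree inside the connected set [~: T] has [#|face G| - 1] edges, which by Euler's
    formula is the size of [~: T]. *)
Lemma tree_dual (G : plane_digraph) (T : {set edge G}) (r : vertex G) (q : face G) :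
  plane G -> spanning_tree T -> spanning_tree (~: T : {set edge (dual G)}).
Proof.
move=> planeG treeT; have [_ _ euler _ _] := planeG.
have [f [d [fP sfT]]] :=
  connected_parent_map (q : vertex (dual G)) (connected_cotree planeG treeT).
suff <- : parent_edges f = ~: T by apply: parent_edges_tree fP.
apply/eqP; rewrite eqEcard sfT /=.
have := card_parent_edges fP; have := card_tree r treeT; have := cardsC T.
rewrite -[vertex (dual G)]/(face G) -[edge (dual G)]/(edge G) in sfT *.
move: euler; clear; lia.
Qed.

(** Otherwise a dual spanning tree avoids [C], and its complement is a spanning tree of [G]
    containing [C]. *)
Lemma cycle_separates (G : plane_digraph) (C : {set edge G}) (q : face G) :
  plane G -> is_cycle C -> ~ connected (~: C : {set edge (dual G)}).
Proof.
move=> planeG cycC conC; have [C0 _ _] := and3P cycC; have [e _] := set0Pn _ C0.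
have [f [d [fP sfC]]] := connected_parent_map (q : vertex (dual G)) conC.
have := @tree_dual (dual G) _ q (tail e) (plane_dual planeG) (parent_edges_tree fP).
case/spanning_treeP=> _ /(_ C cycC)/negP[]; rewrite -setCS setCK.
exact: sfC.
Qed.

(** The inclusion of [~: T] minus [e] in [~: C] gives one direction. Conversely, if [q] lay at the
    other end of [e] in the dual tree, both ends of the dual edge would be joined off [C], hence all
    faces would be, against [cycle_separates]. *)
Lemma externally_active_dual (G : plane_digraph) (T : {set edge G}) (r : vertex G)
    (q : face G) e : plane G -> spanning_tree T -> e \notin T ->
  externally_active T q e
  = internally_active (~: T : {set edge (dual G)}) (q : vertex (dual G)) e.
Proof.
move=> planeG treeT eT; have [conT acT] := spanning_treeP _ treeT.
rewrite /externally_active /ccw_Cyc inE /=.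
(* [e] closes a cycle over [T], so [Cyc] does not take its default value [set0]. *)
have /andP[cycC sC] : is_cycle (Cyc T e) && (Cyc T e \subset e |: T).
  rewrite /Cyc; case: pickP => //= no.
  have [C cycC sC] := joined_cycle eT (conT _ _).
  by have := no C; rewrite cycC sC.
set C := Cyc T e in cycC sC *.
have eC : e \in C.
  apply/negPn/negP => eC; have /negP[] := acT C cycC.
  apply/subsetP => x xC; have /setU1P[xe|//] := subsetP sC x xC.
  by rewrite -xe xC in eC.
rewrite eC /=; pose G' := dual G.
have sTC : ((~: T : {set edge G'}) :\ e \subset (~: C : {set edge G'})).
  apply/subsetP => x; rewrite !inE => /andP[xe xT].
  by apply/negP => /(subsetP sC); rewrite !inE (negPf xe) (negPf xT).
apply/idP/idP => [qC|]; last exact: joinedS sTC.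
apply/negPn/negP => nq.
have treeT' := tree_dual r q planeG treeT.
have [f [d [fP eqT']]] := tree_parent_map (q : vertex G') treeT'.
have /parent_edgesP[v fv] : e \in parent_edges f by rewrite eqT' inE.
have [_ ev _ _] := parent_map_edge fP fv.
have [jo jv] := joined_parent fP fv; rewrite eqT' in jo jv.
have je : joined (~: C : {set edge G'}) (@tail G' e) (@head G' e).
  have jqh : joined (~: C : {set edge G'}) q (@head G' e).
    apply: joinedS sTC _; move: jo; rewrite /opposite.
    by case: eqP => // _ jt; case/negP: nq.
  by apply: joined_trans jqh; rewrite joined_sym.
apply: (@cycle_separates G C q planeG cycC) => u w.
have [conT' _] := spanning_treeP _ treeT'.
apply: joined_sub (conT' u w) => x xT'.
have [->//|xe] := eqVneq x e.
by apply/joined_edge/(subsetP sTC); rewrite in_setD1 xe.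
Qed.

(** * Tait digraphs *)

Section Regions.
Variable D : diagram_code.
Implicit Types (c : crossing D) (i : 'I_4) (h : crossing D * 'I_4) (d : dart D).

Definition prev_side h : crossing D * 'I_4 := mate (h.1, ordS h.2).

Lemma prev_sideK h : next_side (inl (prev_side h)) = inl h.
Proof. by rewrite /= /prev_side mateK /= ordSK -surjective_pairing. Qed.

Lemma next_side_inj : injective (@next_side D).
Proof.
apply: (can_inj (g := fun d => if d is inl h then inl (prev_side h) else d)).
by case=> //= h; rewrite /prev_side /= ord_predK -surjective_pairing mateK.
Qed.

Lemma eq_left_region d d' :
  (left_region d == left_region d') = fconnect (@next_side D) d d'.
Proof.
rewrite -val_eqE /= /side_orbit; apply/eqP/idP => [/setP/(_ d')|dd'].
  by rewrite !inE connect0.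
by apply/setP => x; rewrite !inE; apply: same_connect; first exact: fconnect_sym next_side_inj.
Qed.

Lemma left_region_next d : left_region (next_side d) = left_region d.
Proof. by apply/esym/eqP; rewrite eq_left_region fconnect1. Qed.

Lemma left_region_prev h : left_region (inl (prev_side h)) = left_region (inl h).
Proof. by rewrite -left_region_next prev_sideK. Qed.

Lemma left_region_mate c i :
  left_region (inl (mate (c, i))) = left_region (inl (c, ord_pred i)).
Proof. by rewrite -left_region_next /= mateK. Qed.

Lemma left_region_surj (R : region D) : exists d, R = left_region d.
Proof. by case: R => A A_orb; have [d dA] := codomP A_orb; exists d; apply: val_inj. Qed.

(* Telescoping along the boundary of a region. *)
Lemma boundary_sum (V : zmodType) (g : crossing D * 'I_4 -> V) (R : region D) :
  \sum_(h | left_region (inl h) == R) (g h - g (prev_side h)) = 0.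
Proof.
rewrite sumrB; apply/eqP; rewrite subr_eq0; apply/eqP.
have prev_inj : injective prev_side.
  apply: (can_inj (g := fun h => ((mate h).1, ord_pred (mate h).2))) => h.
  by rewrite mateK /= ordSK -surjective_pairing.
rewrite (reindex_inj prev_inj) /=; apply: eq_bigl => h.
by rewrite left_region_prev.
Qed.

End Regions.

Lemma ordS4 (i : 'I_4) : ordS (ordS (ordS (ordS i))) = i.
Proof. by apply/val_inj; case: i => [[|[|[|[|]]]]]. Qed.

Lemma ord_pred4 (i : 'I_4) : ord_pred i = ordS (ordS (ordS i)).
Proof. by rewrite -[in LHS](ordS4 i) ordSK. Qed.

Lemma sum_ord4 (V : nmodType) (F : 'I_4 -> V) i :
  \sum_j F j = F i + F (ordS i) + F (ordS (ordS i)) + F (ordS (ordS (ordS i))).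
Proof.
transitivity (\sum_(j <- [:: i; ordS i; ordS (ordS i); ordS (ordS (ordS i))]) F j).
  rewrite [RHS]big_uniq /=; last by rewrite !inE; case: i => [[|[|[|[|]]]] // ?].
  by apply: eq_bigl => j; rewrite !inE; case: i j => [[|[|[|[|]]]] // ?] [[|[|[|[|]]]]].
by rewrite !big_cons big_nil addr0 !addrA.
Qed.

Lemma ord4_parity (i j : 'I_4) : odd i = odd j -> i = j \/ i = ordS (ordS j).
Proof.
case: i j => [[|[|[|[|]]]] // ?] [[|[|[|[|]]]] // ?] //= _;
  by [left; apply: val_inj | right; apply: val_inj].
Qed.

(** * Balance and parity around the regions *)

Section TaitDigraph.
Variables (D : link_diagram) (S : shading D).
Local Notation G := (tait_digraph S).
Implicit Types (c : crossing D) (i : 'I_4) (d : dart D).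

Lemma left_region_shaded c i : (left_region (inl (c, i)) \in shaded S) = odd i.
Proof. exact: shaded_crossing. Qed.

Lemma sum_half_edges (V : nmodType) (F : crossing D * 'I_4 -> V) (R : region D) :
  \sum_(h | left_region (inl h) == R) F h
  = \sum_c \sum_i F (c, i) *+ (left_region (inl (c, i)) == R).
Proof.
rewrite pair_big /= big_mkcond; apply: eq_bigr => -[c i] _ /=.
by case: eqP.
Qed.

(** The shaded corners at a crossing are the top and the bottom one, at the head and the tail; a
    loop at [v] counts for both. *)
Lemma vertex_corners (V : nmodType) (F : crossing D * 'I_4 -> V) (v : vertex G) :
  \sum_(h | left_region (inl h) == val v) F h
  = \sum_(c : edge G) (F (c, over_out c) *+ (head c == v)
      + F (c, ordS (ordS (over_out c))) *+ (tail c == v)).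
Proof.
have off c i : ~~ odd i -> (left_region (inl (c, i)) == val v) = false.
  by move=> ei; apply: contraNF ei => /eqP eq_v;
     rewrite -(left_region_shaded c) eq_v (valP v).
rewrite sum_half_edges; apply: eq_bigr => c _.
rewrite (sum_ord4 _ (over_out c)) -[head _ == v]val_eqE -[tail _ == v]val_eqE /=.
rewrite (off c (ordS (over_out c))) ?(off c (ordS (ordS (ordS (over_out c)))));
  by rewrite ?mulr0n ?addr0 ?odd_ordS ?over_out_odd.
Qed.

Lemma face_corners (V : nmodType) (F : crossing D * 'I_4 -> V) (q : face G) :
  \sum_(h | left_region (inl h) == val q) F h
  = \sum_(c : edge G) (F (c, ordS (over_out c)) *+ (left_face c == q)
      + F (c, ord_pred (over_out c)) *+ (right_face c == q)).
Proof.
have off c i : odd i -> (left_region (inl (c, i)) == val q) = false.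
  move=> oi; apply/eqP => eq_q; have := valP q.
  by rewrite -eq_q left_region_shaded oi.
rewrite sum_half_edges; apply: eq_bigr => c _.
rewrite (sum_ord4 _ (over_out c)) -ord_pred4.
rewrite -[left_face _ == q]val_eqE -[right_face _ == q]val_eqE /=.
rewrite (off c (over_out c)) ?(off c (ordS (ordS (over_out c))));
  by rewrite ?mulr0n ?add0r ?addr0 ?odd_ordS ?over_out_odd.
Qed.

Lemma outgoing_over_out c : outgoing (c, over_out c).
Proof.
rewrite /over_out; case: ifP => // /negbT out1.
by have -> : 3%:R = ordS (ordS 1) :> 'I_4; [apply: val_inj | rewrite outgoing_opposite].
Qed.

Lemma positive_crossingE c : positive_crossing c = outgoing (c, ordS (over_out c)).
Proof.
apply/existsP/idP => [[i /and3P[oi out_i out_Si]]|out_S]; last first.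
  by exists (over_out c); rewrite /over_half /= over_out_odd outgoing_over_out.
have [|<-//|i_eq] := @ord4_parity i (over_out c).
  by rewrite over_out_odd.
by move: out_i; rewrite i_eq outgoing_opposite outgoing_over_out.
Qed.

(* Along the boundary of a shaded region the orientation changes exactly at the
   positive crossings. *)
Lemma positive_balanced (R : idomainType) (x : R) :
  balanced (fun c : edge G => if positive c then x else 0).
Proof.
(* The corner at the head of [c] contributes [x] at a positive crossing and 0 at a negative one; the
   corner at the tail contributes the negative of that. *)
move=> v; pose g (h : crossing D * 'I_4) : R := if outgoing h then x else 0.
rewrite -[RHS](boundary_sum g (val v)) vertex_corners; apply: eq_bigr => c _.
rewrite /g /prev_side /= !outgoing_mate !outgoing_opposite outgoing_over_out.
rewrite positive_crossingE negbK.
by case: (outgoing _); case: (_ == v); case: (_ == v); rewrite /= ?mulr0n ?mulr1n; ring.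
Qed.

(** Around an unshaded region the orientation changes exactly at the negative crossings. *)
Lemma negative_balanced (R : idomainType) (x : R) :
  balanced (fun c : edge (dual G) => if positive c then 0 else x).
Proof.
move=> q; pose g (h : crossing D * 'I_4) : R := if outgoing h then x else 0.
rewrite -[RHS](boundary_sum g (val q)) face_corners; apply: eq_bigr => c _.
have out_pred : outgoing (c, ord_pred (over_out c)) = ~~ outgoing (c, ordS (over_out c)).
  by rewrite ord_pred4 outgoing_opposite.
rewrite /g /prev_side /= out_pred ord_predK.
rewrite !outgoing_mate !outgoing_opposite outgoing_over_out.
rewrite positive_crossingE.
by case: (outgoing _); case: (_ == q); case: (_ == q); rewrite /= ?mulr0n ?mulr1n; ring.
Qed.

Lemma natr_degree (R : pzRingType) (H : plane_digraph) (A : {set edge H}) v :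
  (degree A v)%:R
  = \sum_e ((e \in A)%:R *+ (head e == v) + (e \in A)%:R *+ (tail e == v)) :> R.
Proof.
have card_sum (P : pred (edge H)) :
    #|[set e in A | P e]|%:R = \sum_e (e \in A)%:R *+ P e :> R.
  rewrite -sum1dep_card natr_sum big_mkcond; apply: eq_bigr => e _ /=.
  by case: (e \in A); case: (P e).
by rewrite big_split natrD !card_sum addrC.
Qed.

Lemma odd_natr_F2 n : ~~ odd n = (n%:R == 0 :> 'F_2).
Proof. by rewrite -(dvdn_pcharf (pchar_Fp (isT : prime 2))) dvdn2. Qed.

(** Around a shaded region, membership in [X] of the region across the boundary changes exactly at
    the crossings in the cut, and the changes along a closed boundary sum to 0 modulo 2. *)
Lemma tait_dual_cuts_even : dual_cuts_even G.
Proof.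
move=> X v; rewrite odd_natr_F2 natr_degree; apply/eqP.
(* [X] is extended by [false] to the shaded regions. *)
pose X' (R : region D) := if insub R is Some f then X f else false.
have X'E (f : face G) : X' (val f) = X f by rewrite /X' valK.
pose g (h : crossing D * 'I_4) : 'F_2 := (X' (left_region (inl (mate h))))%:R.
rewrite -[RHS](boundary_sum g (val v)) vertex_corners; apply: eq_bigr => c _.
have XL : X' (left_region (inl (c, ordS (over_out c)))) = X (left_face (c : edge G)).
  exact: X'E (left_face (c : edge G)).
have XR : X' (left_region (inl (c, ord_pred (over_out c)))) = X (right_face (c : edge G)).
  exact: X'E (right_face (c : edge G)).
rewrite /g /prev_side /= !mateK !left_region_mate ordSK -ord_pred4 XL XR inE.
rewrite [tail _]/= [head _]/=.
by case: (X _) (X _) => [] []; case: (_ == v); case: (_ == v);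
   rewrite ?mulr0n ?mulr1n; apply/val_inj.
Qed.

(** The same telescoping with shaded and unshaded regions exchanged. *)
Lemma tait_cuts_even : dual_cuts_even (dual G).
Proof.
move=> X q; rewrite odd_natr_F2 natr_degree; apply/eqP.
pose X' (R : region D) := if insub R is Some f then X f else false.
have X'E (v : vertex G) : X' (val v) = X v by rewrite /X' valK.
pose g (h : crossing D * 'I_4) : 'F_2 := (X' (left_region (inl (mate h))))%:R.
rewrite -[RHS](boundary_sum g (val q)) face_corners; apply: eq_bigr => c _.
have XH : X' (left_region (inl (c, over_out c))) = X (head (c : edge G)).
  exact: X'E (head (c : edge G)).
have XT : X' (left_region (inl (c, ordS (ordS (over_out c))))) = X (tail (c : edge G)).
  exact: X'E (tail (c : edge G)).
have pred2 : ord_pred (ord_pred (over_out c)) = ordS (ordS (over_out c)).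
  by rewrite [ord_pred (over_out c)]ord_pred4 ordSK.
rewrite /g /prev_side /= !mateK !left_region_mate ordSK ord_predK pred2 XH XT inE.
rewrite [tail _]/= [head _]/=.
by case: (X _) (X _) => [] []; case: (_ == q); case: (_ == q);
   rewrite ?mulr0n ?mulr1n; apply/val_inj.
Qed.

End TaitDigraph.

(** * Connectivity and Euler's formula for the Tait digraph *)

Section TaitPlane.
Variables (D : link_diagram) (S : shading D).
Hypothesis conD : connected_diagram D.
Local Notation G := (tait_digraph S).
Implicit Types (c : crossing D) (i : 'I_4) (d : dart D) (R : region D).

Lemma flipK : involutive (@flip D).
Proof. by move=> [h|[o b]] /=; rewrite ?mateK ?negbK. Qed.

Lemma dart_adjacent_sym : symmetric (@dart_adjacent D).
Proof.
move=> d d'; rewrite /dart_adjacent; congr (_ || _).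
  by apply/eqP/eqP => ->; rewrite flipK.
by case: d d' => [h|o] [h'|o'] //; rewrite eq_sym.
Qed.

Definition beside d R := (left_region d == R) || (left_region (flip d) == R).

Lemma beside_flip d R : beside (flip d) R = beside d R.
Proof. by rewrite /beside flipK orbC. Qed.

Lemma beside_half_edge c i R :
  beside (inl (c, i)) R -> exists j : 'I_4, left_region (inl (c, j)) = R.
Proof. by case/orP=> /eqP<-; rewrite /= ?left_region_mate; eexists. Qed.

(** The two sides of a dart have opposite shadings. *)
Lemma beside_shaded_unique (b : bool) d R R' :
    (R \in shaded S) = b -> (R' \in shaded S) = b ->
  beside d R -> beside d R' -> R = R'.
Proof.
have pick_side R1 : (R1 \in shaded S) = b -> beside d R1 ->
    R1 = if (left_region d \in shaded S) == b then left_region d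
         else left_region (flip d).
  move=> + /orP[] /eqP R1E; rewrite -R1E ?shaded_flip => <-; rewrite ?eqxx //.
  by case: (_ \in _).
by move=> Rb R'b dR dR'; rewrite (pick_side R Rb dR) (pick_side R' R'b dR').
Qed.

(** Along a path of darts, follow the unique region of colour [b] beside the current dart: flipping
    keeps it, and a move at a crossing is covered by the last hypothesis. The map [reg] lets this
    serve both colours. *)
Lemma connected_regions (b : bool) (V : finType) (reg : V -> region D) (J : rel V) :
    injective reg -> (forall u, (reg u \in shaded S) = b) ->
    (forall R, (R \in shaded S) = b -> exists u, reg u = R) ->
    reflexive J -> transitive J ->
    (forall c (i j : 'I_4) u v, reg u = left_region (inl (c, i)) ->
       reg v = left_region (inl (c, j)) -> J u v) ->
  forall u v, J u v.
Proof.
move=> reg_inj reg_b reg_ex J0 Jt Jc u v.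
have uniq_beside d w w' : beside d (reg w) -> beside d (reg w') -> w = w'.
  by move=> dw dw'; apply/reg_inj/(beside_shaded_unique _ _ dw dw').
have ex_beside d : exists w, beside d (reg w).
  have [db|db] := eqVneq (left_region d \in shaded S) b.
    by have [w wE] := reg_ex _ db; exists w; rewrite /beside wE eqxx.
  have [|w wE] := reg_ex (left_region (flip d)).
    by rewrite shaded_flip; case: (_ \in _) b db {reg_b reg_ex} => -[].
  by exists w; rewrite /beside wE eqxx orbT.
have [[d ud] [d' vd']] := (left_region_surj (reg u), left_region_surj (reg v)).
have bd : beside d (reg u) by rewrite ud /beside eqxx.
have bd' : beside d' (reg v) by rewrite vd' /beside eqxx.
have /connectP[p pth last_p] := conD.2 d d'.
elim: p d u pth last_p {ud} bd => [|d1 p IH] d u /= pth last_p bd.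
  by rewrite last_p in bd'; rewrite (uniq_beside _ _ _ bd bd').
case/andP: pth => adj pth; have [w bd1] := ex_beside d1.
apply: Jt (IH d1 w pth last_p bd1).
case/orP: adj => [/eqP d1E|].
  by rewrite d1E beside_flip in bd1; rewrite (uniq_beside _ _ _ bd bd1).
case: d d1 bd bd1 {IH pth last_p} => [[c i]|//] [[c' j]|//] bd bd1 /eqP /= cc'.
subst c'.
have [[i' i'E] [j' j'E]] := (beside_half_edge bd, beside_half_edge bd1).
by apply: Jc (esym i'E) (esym j'E).
Qed.

Lemma tait_connected : connected [set: edge G].
Proof.
apply: (@connected_regions true (vertex G) (fun u => val u) (joined [set: edge G]));
  first exact: val_inj.
- by move=> u; apply: (valP u).
- by move=> R Rs; exists (exist _ R Rs).
- exact: joined_refl.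
- exact: joined_trans.
move=> c i j u v ui vj.
have joined_tail w k : val w = left_region (inl (c, k)) ->
    joined [set: edge G] w (tail (c : edge G)).
  move=> wk; have : odd k = odd (over_out c).
    by rewrite -(left_region_shaded S c) -wk over_out_odd (valP w).
  case/ord4_parity=> kE; rewrite kE in wk.
    have -> : w = head (c : edge G) by apply: val_inj.
    by rewrite joined_sym joined_edge ?inE.
  have -> : w = tail (c : edge G) by apply: val_inj.
  exact: joined_refl.
by apply: joined_trans (joined_tail u i ui) _; rewrite joined_sym (joined_tail v j).
Qed.

Lemma tait_dual_connected : connected [set: edge (dual G)].
Proof.
apply: (@connected_regions false (vertex (dual G)) (fun u => val u)
          (joined [set: edge (dual G)])); first exact: val_inj.
- by move=> u; apply/negbTE/(valP u).
- by move=> R /negbT Rs; exists (exist _ R Rs).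
- exact: joined_refl.
- exact: joined_trans.
move=> c i j u v ui vj.
have joined_tail w k : val w = left_region (inl (c, k)) ->
    joined [set: edge (dual G)] w (tail (c : edge (dual G))).
  move=> wk; have : odd k = odd (ordS (over_out c)).
    rewrite -(left_region_shaded S c) -wk odd_ordS over_out_odd.
    exact/negbTE/(valP w).
  case/ord4_parity=> kE; rewrite kE in wk.
    have -> : w = tail (c : edge (dual G)) by apply: val_inj.
    exact: joined_refl.
  have -> : w = head (c : edge (dual G)).
    by apply: val_inj; rewrite wk -ord_pred4.
  by rewrite joined_sym joined_edge ?inE.
by apply: joined_trans (joined_tail u i ui) _; rewrite joined_sym (joined_tail v j).
Qed.

(** Vertices and faces together are the regions, and the planarity formula is applied with one
    component. *)
Lemma tait_euler : (#|vertex G| + #|face G| = #|edge G| + 2)%N.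
Proof.
have -> : (#|vertex G| + #|face G| = #|region D|)%N.
  rewrite -[RHS](cardC (mem (shaded S))) [LHS]/= !card_sig.
  by congr (_ + _)%N; apply: eq_card => R; rewrite !inE.
have [[d] conn] := conD.
suff n1 : n_comp (@dart_adjacent D) (dart D) = 1%N by rewrite planarP n1 muln1.
rewrite -(n_comp_connect (sym_connect_sym dart_adjacent_sym) d).
by apply: eq_n_comp_r => d'; rewrite [RHS]conn.
Qed.

Lemma tait_plane : plane G.
Proof.
split; [exact: tait_connected | exact: tait_dual_connected | exact: tait_euler
       | exact: tait_dual_cuts_even | exact: tait_cuts_even].
Qed.

End TaitPlane.

(** * The two symmetries *)

Lemma subst4_tree_polynomial (G : plane_digraph) (r : vertex G) (q : face G)
    (a b c d : {mpoly int[4]}) :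
  subst4 (tree_polynomial r q) a b c d
  = \sum_(T : {set edge G} | spanning_tree T)
      a ^+ iota_pos r T * b ^+ iota_bar_pos r T
      * c ^+ eps_neg q T * d ^+ eps_bar_neg q T.
Proof.
rewrite /subst4 rmorph_sum; apply: eq_bigr => T _ /=.
by rewrite !rmorphM !rmorphXn /= !comp_mpolyXU.
Qed.

(** Brings the activity monomials into the form of [tree_weight], edges outside [p] having weight
    1. *)
Lemma prod_weights (R : comNzRingType) (I : finType) (A : {set I})
    (p s : pred I) (x y : R) :
  x ^+ #|[set e in A | p e && s e]| * y ^+ #|[set e in A | p e && ~~ s e]|
  = \prod_(e in A) (if s e then if p e then x else 1 else if p e then y else 1).
Proof.
rewrite -!prodr_const (big_mkcond (fun e => e \in A)) !(big_mkcond (fun e => e \in _)) /=.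
rewrite -big_split; apply: eq_bigr => e _ /=; rewrite !inE.
by case: (e \in A); case: (s e); case: (p e); rewrite ?mulr1 ?mul1r.
Qed.

Section Symmetry.
Variables (R : idomainType) (D : link_diagram) (S : shading D).
Variables (r : vertex (tait_digraph S)) (q : face (tait_digraph S)) (x y : R).
Local Notation G := (tait_digraph S).

Lemma iota_pos_symmetric :
  \sum_(T : {set edge G} | spanning_tree T) x ^+ iota_pos r T * y ^+ iota_bar_pos r T
  = \sum_(T : {set edge G} | spanning_tree T) y ^+ iota_pos r T * x ^+ iota_bar_pos r T.
Proof.
under eq_bigr do rewrite prod_weights.
under [RHS]eq_bigr do rewrite prod_weights.
(* Both weights are 1 on negative edges, so their difference is [x - y] on positive edges and 0
   elsewhere. *)
apply: tree_weight_swap => v; rewrite -[RHS](positive_balanced (x - y) v).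
by apply: eq_bigr => e _; case: positive; rewrite ?subrr.
Qed.

Lemma eps_neg_symmetric : connected_diagram D ->
  \sum_(T : {set edge G} | spanning_tree T) x ^+ eps_neg q T * y ^+ eps_bar_neg q T
  = \sum_(T : {set edge G} | spanning_tree T) y ^+ eps_neg q T * x ^+ eps_bar_neg q T.
Proof.
move=> conD; have planeG := tait_plane S conD.
pose a z (e : edge (dual G)) : R := if positive e then 1 else z.
(* Complementing trees turns external activity into internal activity in the dual, where positive
   edges have weight 1. *)
have dual_sum z w :
    \sum_(T : {set edge G} | spanning_tree T) z ^+ eps_neg q T * w ^+ eps_bar_neg q T
    = \sum_(T | spanning_tree T) tree_weight (q : vertex (dual G)) (a z) (a w) T.
  rewrite [RHS](reindex_inj (@setC_inj (edge G))).
  apply: eq_big => [T|T treeT].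
    apply/idP/idP => [/(tree_dual r q planeG)//|].
    by move/(@tree_dual (dual G) _ q r (plane_dual planeG)); rewrite setCK.
  rewrite prod_weights; apply: eq_bigr => e; rewrite inE => eT.
  rewrite (externally_active_dual r q planeG treeT eT) /a.
  by rewrite !if_neg.
rewrite !dual_sum; apply: tree_weight_swap => f.
rewrite -[RHS](negative_balanced (x - y) f).
by apply: eq_bigr => e _; rewrite /a; case: positive; rewrite ?subrr.
Qed.

End Symmetry.

Theorem theorem1p2 (D : link_diagram) (S : shading D)
    (r : vertex (tait_digraph S)) (q : face (tait_digraph S)) :
  connected_diagram D -> alternating D -> incident r q ->
  subst4 (P_ r q) xinv yinv 1 1 = subst4 (P_ r q) yinv xinv 1 1
  /\ subst4 (P_ r q) 1 1 zvar wvar = subst4 (P_ r q) 1 1 wvar zvar.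
Proof.
move=> conD _ _; rewrite /P_ !subst4_tree_polynomial; split.
  under eq_bigr do rewrite !expr1n !mulr1.
  under [RHS]eq_bigr do rewrite !expr1n !mulr1.
  exact: iota_pos_symmetric.
under eq_bigr do rewrite !expr1n !mul1r.
under [RHS]eq_bigr do rewrite !expr1n !mul1r.
exact: eps_neg_symmetric.
Qed.
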